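(* Let $\Lambda$ be a rank-$3$ lattice in $\mathbb{E}^3$ preserved by $\tilde{\mathbf{D}}_2$. Then there exists a diagonal transformation $D$ such that $$\Lambda D^{-1}\in\{\Lambda_{(1,0,0)},\ \Lambda_{(1,1,1)},\ \Lambda_{(1,1,0)},\ \Lambda_{(1,1)}\oplus e_3,\ 2\Lambda_{(1,0)}\oplus(e_1+e_3),\ 2\Lambda_{(1,0)}\oplus(e_2+e_3)\}.$$
   Context: A rank-$d$ lattice is the set of integer linear combinations of $d$ linearly independent vectors of $\mathbb{E}^3$. $\tilde{\mathbf{D}}_2$ is the group generated by the reflections in the planes $x=0$ and $y=0$. A lattice is preserved by a group of linear isometries if every element of the group maps the lattice to itself. $\{e_1,e_2,e_3\}$ is the standard basis. A diagonal transformation is an invertible linear map with diagonal matrix in this basis, and $\Lambda T=\{vT:v\in\Lambda\}$ for a linear map $T$. $\Lambda_{(1,0,0)}=\mathbb{Z}^3$; $\Lambda_{(1,1,1)}$ is the set of integral vectors all of whose coordinates have the same parity; $\Lambda_{(1,1,0)}$ is the set of integral vectors whose coordinate sum is even. $\Lambda_{(1,0)}$ is the rank-$2$ lattice generated by $e_1,e_2$ and $\Lambda_{(1,1)}$ the rank-$2$ lattice generated by $e_1+e_2,e_1-e_2$. For a lattice $\Lambda_0$ in a subspace $V$ and a vector $w\notin V$, $\Lambda_0\oplus w=\bigcup_{k\in\mathbb{Z}}(\Lambda_0+kw)$. *)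

(* Defs.v *)
From HB Require Import structures.
From mathcomp Require Import all_boot all_order all_algebra.
From mathcomp Require Import boolp classical_sets reals.

Set Implicit Arguments.
Unset Strict Implicit.
Unset Printing Implicit Defensive.

Import Order.TTheory GRing.Theory Num.Theory.
Local Open Scope classical_set_scope.
Local Open Scope ring_scope.

(* Vectors of E^3 are row vectors, and a linear map T is a matrix acting on the
   right: v T is v *m T. *)

Definition int_span (R : realType) (d : nat) (B : 'M[R]_(d, 3)) :
    set 'rV[R]_3 :=
  [set v | exists c : 'rV[int]_d, v = map_mx intr c *m B].

Definition is_lattice (R : realType) (d : nat) (L : set 'rV[R]_3) : Prop :=
  exists2 B : 'M[R]_(d, 3), row_free B & L = int_span B.

Definition lattice_image (R : realType) (L : set 'rV[R]_3) (T : 'M[R]_3) :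
    set 'rV[R]_3 :=
  [set v *m T | v in L].

Definition is_linear_group (R : realType) (G : set 'M[R]_3) : Prop :=
  [/\ forall g, G g -> g \in unitmx,
      G 1%:M,
      forall g h, G g -> G h -> G (g *m h) &
      forall g, G g -> G (invmx g)].

Definition generated_group (R : realType) (S : set 'M[R]_3) : set 'M[R]_3 :=
  smallest (@is_linear_group R) S.

(* The reflection in the coordinate plane x_i = 0. *)
Definition coord_reflection (R : realType) (i : 'I_3) : 'M[R]_3 :=
  diag_mx (\row_j (if j == i then -1 else 1)).

Definition D2_tilde (R : realType) : set 'M[R]_3 :=
  generated_group [set coord_reflection R 0; coord_reflection R 1].
Arguments D2_tilde : clear implicits.

Definition preserved_by (R : realType) (L : set 'rV[R]_3) (G : set 'M[R]_3) :
    Prop :=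
  forall g, G g -> lattice_image L g = L.

Definition diagonal_transformation (R : realType) (D : 'M[R]_3) : Prop :=
  (D \in unitmx) /\ is_diag_mx D.

Definition e1 (R : realType) : 'rV[R]_3 := delta_mx 0 0.
Definition e2 (R : realType) : 'rV[R]_3 := delta_mx 0 1.
Definition e3 (R : realType) : 'rV[R]_3 := delta_mx 0 2.

Definition Lambda100 (R : realType) : set 'rV[R]_3 :=
  [set v | exists z : 'rV[int]_3, v = map_mx intr z].
Arguments Lambda100 : clear implicits.

Definition Lambda111 (R : realType) : set 'rV[R]_3 :=
  [set v | exists2 z : 'rV[int]_3, v = map_mx intr z &
     forall i j : 'I_3, (z 0%R i = z 0%R j %[mod 2])%Z].
Arguments Lambda111 : clear implicits.

Definition Lambda110 (R : realType) : set 'rV[R]_3 :=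
  [set v | exists2 z : 'rV[int]_3, v = map_mx intr z &
     (2 %| (\sum_(i < 3) z 0 i)%R)%Z].
Arguments Lambda110 : clear implicits.

Definition Lambda10 (R : realType) : set 'rV[R]_3 :=
  int_span (col_mx (e1 R) (e2 R)).
Arguments Lambda10 : clear implicits.

Definition Lambda11 (R : realType) : set 'rV[R]_3 :=
  int_span (col_mx (e1 R + e2 R) (e1 R - e2 R)).
Arguments Lambda11 : clear implicits.

Definition lattice_scale (R : realType) (a : R) (L : set 'rV[R]_3) :
    set 'rV[R]_3 :=
  [set a *: v | v in L].

Definition lattice_oplus (R : realType) (L : set 'rV[R]_3) (w : 'rV[R]_3) :
    set 'rV[R]_3 :=
  \bigcup_(k in [set: int]) [set u + w *~ k | u in L].

(* Main.v *)
Require Import Defs.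
From HB Require Import structures.
From mathcomp Require Import all_boot all_order all_algebra.
From mathcomp Require Import boolp classical_sets reals.
From mathcomp Require Import zify ring.

(** If [v = (x, y, z)] lies in [L], then so do its images under the reflections,
    and adding or subtracting these from [v] shows that [(2x, 0, 0)],
    [(0, 2y, 0)] and [(0, 0, 2z)] lie in [L]: twice each coordinate projection
    of [L] falls back into [L] ([D2_tilde_double_coord]).  The points of [L] on
    a coordinate axis form a nonzero cyclic group, since some coordinate with
    respect to a basis of [L] embeds them into the integers
    ([lattice_axis_cyclic]).  Taking half of a generator on each axis as the new
    unit of length, [L] becomes a subgroup of the integer vectors that meets
    each axis exactly in the even multiples of the unit
    ([D2_tilde_lattice_half_axes]).

    Such a subgroup contains all vectors with even coordinates, so it is
    determined by its reduction modulo 2, a linear subspace of [F_2^3] without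
    vectors of weight one.  The sum of [111] and a vector of weight two has
    weight one, and any two vectors of weight two sum to the third; hence the
    subspace is [0], a line spanned by [111], [110], [101] or [011], or the plane
    of even weight vectors ([parity_subgroup_classification]).  These six subspaces are
    the six lattices of the theorem, up to doubling the unit of length on all
    axes for the subspace [0] and on the third axis for the line of [110]. *)

Set Implicit Arguments.
Unset Strict Implicit.
Unset Printing Implicit Defensive.

Import Order.TTheory GRing.Theory Num.Theory.
Local Open Scope classical_set_scope.
Local Open Scope ring_scope.

(** * Subgroups of a field that embed into the integers *)

Lemma subgroup_mulrz (V : zmodType) (A : V -> Prop) (t : V) (k : int) :
  (forall s t, A s -> A t -> A (s - t)) -> A t -> A (t *~ k).
Proof.
move=> AB At.
have A0 : A 0 by rewrite -(subrr t); exact: AB.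
have AN s : A s -> A (- s) by rewrite -[- s]add0r; exact: AB.
have An (n : nat) : A (t *+ n).
  elim: n => [|n IH]; first by rewrite mulr0n.
  by rewrite mulrSr -[t in _ + t]opprK; apply: (AB) => //; exact: AN.
by case: k => n; [exact: An | exact/AN/An].
Qed.

(** Multiplication by [u] embeds the subgroup [A] into the integers, so an
    element with the least positive image generates [A]; this replaces a
    topological discreteness argument. *)
Lemma subgroup_int_multiples_cyclic (F : numFieldType) (A : F -> Prop) (u : F) :
    u != 0 -> (forall s t, A s -> A t -> A (s - t)) ->
    (forall t, A t -> exists k : int, t * u = k%:~R) ->
    (exists2 t, A t & t != 0) ->
  exists2 a, a != 0 & forall t, A t <-> exists k : int, t = a * k%:~R.
Proof.
move=> u0 AB Aint [t0 At0 t0_neq0].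
have Az t k := @subgroup_mulrz F A t k AB.
(* Q is shifted by one so that ex_minn ranges over positive images only. *)
pose Q n := `[< exists2 t, A t & t * u = n.+1%:R >].
have exQ : exists n, Q n.
  have [k ek] := Aint _ At0.
  have k0 : k != 0.
    by apply: contra_neq (mulf_neq0 t0_neq0 u0) => k0; rewrite ek k0.
  (* The sign of k makes the image of t0 positive. *)
  exists `|k|.-1%N; apply/asboolP; exists (t0 *~ sgz k); first exact: Az.
  rewrite mulrzAl ek -mulrzr -intrM pmulrn.
  by congr (_%:~R); lia.
case: (ex_minnP exQ) => n /asboolP[a Aa ea] n_min.
have a0 : a != 0.
  by apply: contra_eq_neq ea => ->; rewrite mul0r eq_sym pnatr_eq0.
exists a => // t; split=> [At|[k ->]]; last by rewrite mulrzr; exact: Az.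
have [m em] := Aint _ At.
exists (m %/ n.+1%:Z)%Z.
set q := (m %/ _)%Z; pose r := (m %% n.+1%:Z)%Z.
have Ar : A (t - a *~ q) by apply: AB => //; exact: Az.
have er : (t - a *~ q) * u = r%:~R.
  rewrite mulrBl mulrzAl em ea -[_ *~ q]mulrzr pmulrn -intrM -intrB.
  by congr (_%:~R); rewrite /r /q; lia.
have r0 : r = 0.
  apply: contrapT => r_neq0.
  have : Q `|r|.-1%N.
    apply/asboolP; exists (t - a *~ q) => //.
    by rewrite er pmulrn; congr (_%:~R); rewrite /r in r_neq0 *; lia.
  by move/n_min; rewrite /r in r_neq0 *; lia.
move/eqP: er; rewrite r0 mulf_eq0 (negbTE u0) orbF subr_eq0 mulrzr.
by move/eqP.
Qed.

(** * Points of a lattice on a coordinate axis *)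

Lemma int_spanB (R : realType) d (B : 'M[R]_(d, 3)) u v :
  int_span B u -> int_span B v -> int_span B (u - v).
Proof. by move=> [c ->] [d' ->]; exists (c - d'); rewrite map_mxB mulmxBl. Qed.

(** The coordinates of [t *: e_i] in the basis [B] are [t] times row [i] of the
    inverse of [B]; a nonzero entry of that row is the multiplier that turns all
    [t] with [t *: e_i] in [L] into integers. *)
Lemma lattice_axis_cyclic (R : realType) (L : set 'rV[R]_3) (i : 'I_3) :
    is_lattice 3 L -> (forall v, L v -> L ((v 0 i *+ 2) *: delta_mx 0 i)) ->
  exists2 a, a != 0 &
    forall t, L (t *: delta_mx 0 i) <-> exists k : int, t = a * k%:~R.
Proof.
move=> [B]; rewrite row_free_unit => Bunit -> Ldouble.
have [j uj] : exists j, invmx B i j != 0.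
  apply/existsP; rewrite -negb_forall; apply: contraL Bunit.
  move=> /forallP Bi0; rewrite -unitmx_inv unitmxE (expand_det_row _ i).
  by rewrite big1 ?unitr0 // => j _; rewrite (eqP (Bi0 j)) mul0r.
apply: subgroup_int_multiples_cyclic uj _ _ _.
- by move=> s t Ls Lt; rewrite scalerBl; exact: int_spanB.
- move=> t [c ec]; exists (c 0 j).
  have /rowP/(_ j) := congr1 (mulmx^~ (invmx B)) ec.
  by rewrite mulmxK // -scalemxAl -rowE !mxE.
- have [k Bki] : exists k, B k i != 0.
    apply/existsP; rewrite -negb_forall; apply: contraL Bunit.
    move=> /forallP Bi0; rewrite unitmxE (expand_det_col _ i).
    by rewrite big1 ?unitr0 // => k _; rewrite (eqP (Bi0 k)) mul0r.
  exists (B k i *+ 2); last by rewrite mulrn_eq0.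
  have <- : row k B 0 i = B k i by rewrite mxE.
  apply: Ldouble; exists (delta_mx 0 k); by rewrite map_delta_mx -rowE.
Qed.

(** The hypothesis makes only the doubled coordinates multiples of a generator of
    the points on the axis, so the unit [h] has to be half of that generator. *)
Lemma lattice_half_axis (R : realType) (L : set 'rV[R]_3) (i : 'I_3) :
    is_lattice 3 L -> (forall v, L v -> L ((v 0 i *+ 2) *: delta_mx 0 i)) ->
  exists2 h, h != 0 &
    (forall k : int, L ((k%:~R * h) *: delta_mx 0 i) <-> (2 %| k)%Z) /\
    (forall v, L v -> exists k : int, v 0 i = k%:~R * h).
Proof.
move=> hL Ldouble; have [a a0 aP] := lattice_axis_cyclic hL Ldouble.
exists (a / 2); first by rewrite mulf_neq0 ?invr_eq0 ?pnatr_eq0.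
split=> [k | v /Ldouble/aP[n en]]; last first.
  by exists n; rewrite mulrCA mulrA -en; field.
split=> [/aP[n]|/dvdzP[n ->]]; last first.
  by apply/aP; exists n; rewrite rmorphM /=; field.
rewrite mulrCA => /(mulfI a0) /(canRL (mulfVK _)) ek.
have : k = n * 2 by apply: (@intr_inj R); rewrite rmorphM ek ?pnatr_eq0.
by lia.
Qed.

(** * Row vectors with three entries *)

Definition vec3 (V : nmodType) (x y z : V) : 'rV[V]_3 := \row_j [:: x; y; z]`_j.

Lemma row3P (V : nmodType) (u v : 'rV[V]_3) :
  u 0 0 = v 0 0 -> u 0 1 = v 0 1 -> u 0 2 = v 0 2 -> u = v.
Proof.
move=> h0 h1 h2; apply/rowP => -[[|[|[|//]]] p];
  [move: h0 | move: h1 | move: h2]; by congr (u _ _ = v _ _); apply: val_inj.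
Qed.

Lemma vec3_eta (V : nmodType) (v : 'rV[V]_3) : v = vec3 (v 0 0) (v 0 1) (v 0 2).
Proof. by apply: row3P; rewrite mxE. Qed.

Lemma vec3D (V : nmodType) (x y z x' y' z' : V) :
  vec3 x y z + vec3 x' y' z' = vec3 (x + x') (y + y') (z + z').
Proof. by apply: row3P; rewrite !mxE. Qed.

Lemma vec3B (V : zmodType) (x y z x' y' z' : V) :
  vec3 x y z - vec3 x' y' z' = vec3 (x - x') (y - y') (z - z').
Proof. by apply: row3P; rewrite !mxE. Qed.

Lemma vec3Z (K : pzRingType) (a x y z : K) :
  a *: vec3 x y z = vec3 (a * x) (a * y) (a * z).
Proof. by apply: row3P; rewrite !mxE. Qed.

Lemma vec3_intr (K : pzRingType) (k l m : int) :
  map_mx intr (vec3 k l m) = vec3 k%:~R l%:~R m%:~R :> 'rV[K]_3.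
Proof. by apply: row3P; rewrite !mxE. Qed.

Lemma vec3_diag (K : pzRingType) (x y z a b c : K) :
  vec3 x y z *m diag_mx (vec3 a b c) = vec3 (x * a) (y * b) (z * c).
Proof. by apply: row3P; rewrite mul_mx_diag !mxE. Qed.

Lemma vec3_axis (K : pzRingType) :
  [/\ delta_mx 0 0 = vec3 1 0 0 :> 'rV[K]_3,
      delta_mx 0 1 = vec3 0 1 0 :> 'rV[K]_3
    & delta_mx 0 2 = vec3 0 0 1 :> 'rV[K]_3].
Proof. by split; apply: row3P; rewrite !mxE. Qed.

(** * The six target lattices as congruence conditions on integer vectors *)

Definition int_vectors (R : realType) (P : int -> int -> int -> Prop) :
    set 'rV[R]_3 :=
  [set v | exists k l m : int, v = vec3 k%:~R l%:~R m%:~R /\ P k l m].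
Arguments int_vectors : clear implicits.

Lemma Lambda100E (R : realType) :
  Lambda100 R = int_vectors R (fun _ _ _ => True).
Proof.
apply/seteqP; split=> v.
  by move=> [z ->]; rewrite (vec3_eta z) vec3_intr; do 3!eexists.
by move=> [k [l [m [-> _]]]]; exists (vec3 k l m); rewrite vec3_intr.
Qed.

Lemma Lambda111E (R : realType) : Lambda111 R =
  int_vectors R (fun k l m => (k = l %[mod 2])%Z /\ (l = m %[mod 2])%Z).
Proof.
apply/seteqP; split=> v.
  move=> [z -> h]; rewrite {1}(vec3_eta z) vec3_intr.
  by do 3!eexists; split; first by [].
move=> [k [l [m [-> [kl lm]]]]]; exists (vec3 k l m); rewrite ?vec3_intr //.
by move=> -[[|[|[|//]]] p] [[|[|[|//]]] q]; rewrite !mxE /=; lia.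
Qed.

Lemma Lambda110E (R : realType) : Lambda110 R =
  int_vectors R (fun k l m => (2 %| k + l + m)%Z).
Proof.
have sum3 (z : 'rV[int]_3) : \sum_(i < 3) z 0 i = z 0 0 + z 0 1 + z 0 2.
  rewrite 3!big_ord_recl big_ord0 addr0 addrA.
  by congr (_ + z 0 _ + z 0 _); apply: val_inj.
apply/seteqP; split=> v.
  move=> [z ->]; rewrite {2}(vec3_eta z) vec3_intr sum3 => h.
  by do 3!eexists; split; first by [].
move=> [k [l [m [-> h]]]]; exists (vec3 k l m); rewrite ?vec3_intr //.
by rewrite sum3 !mxE.
Qed.

Lemma int_span_col2 (R : realType) (u w v : 'rV[R]_3) :
  int_span (col_mx u w) v <-> exists k l : int, v = k%:~R *: u + l%:~R *: w.
Proof.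
split=> [[c ->]|[k [l ->]]].
  exists (lsubmx c 0 0), (rsubmx c 0 0).
  rewrite -{1}[c]hsubmxK map_row_mx mul_row_col.
  rewrite (mx11_scalar (lsubmx c)) (mx11_scalar (rsubmx c)) !map_scalar_mx.
  by rewrite !mul_scalar_mx !mxE !mulr1n.
exists (row_mx k%:M l%:M).
by rewrite map_row_mx mul_row_col !map_scalar_mx !mul_scalar_mx.
Qed.

Lemma Lambda11_oplusE (R : realType) : lattice_oplus (Lambda11 R) (e3 R) =
  int_vectors R (fun k l _ => (2 %| k + l)%Z).
Proof.
have [ex ey ez] := vec3_axis R.
apply/seteqP; split=> v.
  move=> [m _ [u /int_span_col2[k [l ->]] <-]].
  exists (k + l), (k - l), m; split; last by lia.
  rewrite -scaler_int /e1 /e2 /e3 ex ey ez vec3B !(vec3D, vec3Z).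
  rewrite rmorphD rmorphB /=.
  by congr vec3; ring.
move=> [k [l [m [-> h]]]]; exists m => //.
exists (((k + l) %/ 2)%Z%:~R *: (e1 R + e2 R) +
        ((k - l) %/ 2)%Z%:~R *: (e1 R - e2 R)).
  by apply/int_span_col2; do 2!eexists.
rewrite -scaler_int /e1 /e2 /e3 ex ey ez vec3B !(vec3D, vec3Z).
rewrite !(mulr0, mulr1, addr0, add0r, oppr0, sub0r, mulrN1) -?intrN -!intrD.
by congr vec3; congr (_%:~R); lia.
Qed.

(** Both remaining targets are covered by taking [(a, b)] to be [(1, 0)] or
    [(0, 1)]. *)
Lemma double_Lambda10_oplusE (R : realType) (a b : int) :
  lattice_oplus (lattice_scale 2 (Lambda10 R)) (vec3 a%:~R b%:~R 1) =
  int_vectors R (fun k l m => (k = a * m %[mod 2])%Z /\ (l = b * m %[mod 2])%Z).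
Proof.
have [ex ey ez] := vec3_axis R.
apply/seteqP; split=> v.
  move=> [m _ [_ [u /int_span_col2[k [l ->]] <-] <-]].
  exists (2 * k + a * m), (2 * l + b * m), m; split; last by lia.
  rewrite -scaler_int /e1 /e2 /e3 ex ey !(vec3D, vec3Z) !rmorphD !rmorphM /=.
  by congr vec3; ring.
move=> [k [l [m [-> h]]]]; exists m => //.
exists (2 *: (((k - a * m) %/ 2)%Z%:~R *: e1 R +
        ((l - b * m) %/ 2)%Z%:~R *: e2 R)).
  by eexists; [apply/int_span_col2; do 2!eexists | ].
rewrite -scaler_int /e1 /e2 ex ey !(vec3D, vec3Z).
rewrite !(mulr0, mulr1, addr0, add0r) -[2]/(2%:~R) !pmulrn -!intrM -!intrD.
by congr vec3; congr (_%:~R); lia.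
Qed.

(** * Consequences of the reflection symmetry *)

Lemma coord_reflection0 (R : realType) (x y z : R) :
  vec3 x y z *m coord_reflection R 0 = vec3 (- x) y z.
Proof.
by apply: row3P; rewrite /coord_reflection mul_mx_diag !mxE ?mulrN1 ?mulr1.
Qed.

Lemma coord_reflection1 (R : realType) (x y z : R) :
  vec3 x y z *m coord_reflection R 1 = vec3 x (- y) z.
Proof.
by apply: row3P; rewrite /coord_reflection mul_mx_diag !mxE ?mulrN1 ?mulr1.
Qed.

Lemma D2_tilde_closed (R : realType) (L : set 'rV[R]_3) (x y z : R) :
    preserved_by L (D2_tilde R) -> L (vec3 x y z) ->
  L (vec3 (- x) y z) /\ L (vec3 x (- y) z).
Proof.
move=> Lpres Lv; split.
  rewrite -coord_reflection0 -(Lpres (coord_reflection R 0)).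
    by exists (vec3 x y z).
  by apply: sub_gen_smallest; left.
rewrite -coord_reflection1 -(Lpres (coord_reflection R 1)).
  by exists (vec3 x y z).
by apply: sub_gen_smallest; right.
Qed.

(** Subtracting a reflected copy isolates twice the reflected coordinate.  For
    [z] there is no reflection in the group; adding the image under the
    half-turn [(x, y, z) |-> (-x, -y, z)] serves instead. *)
Lemma D2_tilde_double_coord (R : realType) (L : set 'rV[R]_3) (i : 'I_3) v :
    is_lattice 3 L -> preserved_by L (D2_tilde R) -> L v ->
  L ((v 0 i *+ 2) *: delta_mx 0 i).
Proof.
move=> [B _ eL] Lpres; rewrite (vec3_eta v).
move: (v 0 0) (v 0 1) (v 0 2) => x y z Lv.
have LB u w : L u -> L w -> L (u - w) by rewrite eL; exact: int_spanB.
have [Lx Ly] := D2_tilde_closed Lpres Lv.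
have [Lxy _] := D2_tilde_closed Lpres Ly.
have L0 := LB _ _ Lv Lv.
case: i => [[|[|[|//]]] p].
- have := LB _ _ Lv Lx; congr L.
  by rewrite vec3B; apply: row3P; rewrite !mxE /=; ring.
- have := LB _ _ Lv Ly; congr L.
  by rewrite vec3B; apply: row3P; rewrite !mxE /=; ring.
- have := LB _ _ Lv (LB _ _ L0 Lxy); congr L.
  by rewrite !vec3B; apply: row3P; rewrite !mxE /=; ring.
Qed.

Lemma D2_tilde_lattice_half_axes (R : realType) (L : set 'rV[R]_3) :
    is_lattice 3 L -> preserved_by L (D2_tilde R) ->
  exists a b c : R, [/\ a != 0, b != 0 & c != 0] /\
    let P (k l m : int) := L (vec3 (k%:~R * a) (l%:~R * b) (m%:~R * c)) in
    [/\ forall k, P k 0 0 <-> (2 %| k)%Z,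
        forall k, P 0 k 0 <-> (2 %| k)%Z,
        forall k, P 0 0 k <-> (2 %| k)%Z &
        forall v, L v -> exists k l m : int,
          v = vec3 (k%:~R * a) (l%:~R * b) (m%:~R * c)].
Proof.
move=> hL Lpres.
have double i v := @D2_tilde_double_coord R L i v hL Lpres.
have [ex ey ez] := vec3_axis R.
have [a a0 [Pa La]] := lattice_half_axis hL (double 0).
have [b b0 [Pb Lb]] := lattice_half_axis hL (double 1).
have [c c0 [Pc Lc]] := lattice_half_axis hL (double 2).
exists a, b, c; split=> //; split.
- by move=> k; rewrite -Pa ex vec3Z mulr1 !(mul0r, mulr0).
- by move=> k; rewrite -Pb ey vec3Z mulr1 !(mul0r, mulr0).
- by move=> k; rewrite -Pc ez vec3Z mulr1 !(mul0r, mulr0).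
- move=> v Lv; have [k ek] := La _ Lv; have [l el] := Lb _ Lv.
  have [m em] := Lc _ Lv.
  by exists k, l, m; rewrite -ek -el -em -vec3_eta.
Qed.

(** * Subgroups of the integer vectors determined by parities *)

(** [P] contains all vectors with even coordinates, so it is a union of parity
    classes.  The classes of weight one are excluded by the axis conditions, and
    the choices for the four remaining classes 110, 101, 011, 111 that are
    compatible with addition are exactly the six alternatives. *)
Lemma parity_subgroup_classification (P : int -> int -> int -> Prop) :
    (forall k l m k' l' m', P k l m -> P k' l' m' ->
       P (k - k') (l - l') (m - m')) ->
    (forall k, P k 0 0 <-> (2 %| k)%Z) -> (forall k, P 0 k 0 <-> (2 %| k)%Z) ->
    (forall k, P 0 0 k <-> (2 %| k)%Z) ->
  let same (k l : int) := (k = l %[mod 2])%Z in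
  let even (k : int) := (2 %| k)%Z in
  (forall k l m, P k l m <-> even k /\ even l /\ even m) \/
  (forall k l m, P k l m <-> same k l /\ same l m) \/
  (forall k l m, P k l m <-> even (k + l + m)) \/
  (forall k l m, P k l m <-> same k l /\ even m) \/
  (forall k l m, P k l m <-> same k m /\ even l) \/
  (forall k l m, P k l m <-> same l m /\ even k).
Proof.
move=> PB Px Py Pz same even.
have P0 : P 0 0 0 by apply/Px.
have Peven k l m : even k -> even l -> even m -> P k l m.
  move=> /Px hk /Py hl /Pz hm.
  have := PB _ _ _ _ _ _ P0 (PB _ _ _ _ _ _ (PB _ _ _ _ _ _ P0 hk)
    (PB _ _ _ _ _ _ hl (PB _ _ _ _ _ _ P0 hm))).
  by congr P; lia.
have Pcongr k l m k' l' m' :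
    same k k' -> same l l' -> same m m' -> P k l m <-> P k' l' m'.
  move=> hk hl hm.
  have P_diff : P (k - k') (l - l') (m - m').
    by apply: Peven; rewrite /even /same in hk hl hm *; lia.
  have P_diff' : P (k' - k) (l' - l) (m' - m).
    by have := PB _ _ _ _ _ _ P0 P_diff; congr P; lia.
  split=> Pk; [have := PB _ _ _ _ _ _ Pk P_diff
            |have := PB _ _ _ _ _ _ Pk P_diff'];
    by congr P; lia.
have N100 : ~ P 1 0 0 by move/Px.
have N010 : ~ P 0 1 0 by move/Py.
have N001 : ~ P 0 0 1 by move/Pz.
have add k l m k' l' m' k'' l'' m'' : P k l m -> P k' l' m' ->
    same (k - k') k'' -> same (l - l') l'' -> same (m - m') m'' ->
  P k'' l'' m''.
  move=> Pk Pk' ? ? ?; apply/(Pcongr (k - k') (l - l') (m - m')) => //.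
  exact: PB.
have parity k : same k 0 \/ same k 1 by rewrite /same; lia.
(* Comparison of P with a union Q of parity classes reduces to the classes of
   weight at least two. *)
have classify (Q : int -> int -> int -> Prop) :
    (forall k l m k' l' m', same k k' -> same l l' -> same m m' ->
       Q k l m <-> Q k' l' m') ->
    Q 0 0 0 -> ~ Q 1 0 0 -> ~ Q 0 1 0 -> ~ Q 0 0 1 ->
    (P 1 1 0 <-> Q 1 1 0) -> (P 1 0 1 <-> Q 1 0 1) -> (P 0 1 1 <-> Q 0 1 1) ->
    (P 1 1 1 <-> Q 1 1 1) -> forall k l m, P k l m <-> Q k l m.
  move=> Qcongr Q000 Q100 Q010 Q001 PQ110 PQ101 PQ011 PQ111 k l m.
  have [hk|hk] := parity k; have [hl|hl] := parity l;
    have [hm|hm] := parity m; rewrite (Pcongr _ _ _ _ _ _ hk hl hm)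
      (Qcongr _ _ _ _ _ _ hk hl hm) //; tauto.
(* Each discarded combination exhibits two vectors of P whose difference lies in
   a class outside P. *)
have [p|p] := pselect (P 1 1 0); have [q|q] := pselect (P 1 0 1);
  have [r|r] := pselect (P 0 1 1); have [s|s] := pselect (P 1 1 1);
  try solve [
    case: N001; exact: (add _ _ _ _ _ _ _ _ _ p s)
  | case: N010; exact: (add _ _ _ _ _ _ _ _ _ q s)
  | case: N100; exact: (add _ _ _ _ _ _ _ _ _ r s)
  | case: r; exact: (add _ _ _ _ _ _ _ _ _ p q)
  | case: q; exact: (add _ _ _ _ _ _ _ _ _ p r)
  | case: p; exact: (add _ _ _ _ _ _ _ _ _ q r)].
1: do 2 right; left.
2: do 3 right; left.
3: do 4 right; left.
4: do 5 right.
5: right; left.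
6: left.
all: apply: classify; rewrite /even /same;
  first [lia | by split=> h; first [lia | assumption | contradiction]].
Qed.

(** * The diagonal transformation *)

(** The factors [s], [t], [r] enlarge the units [a], [b], [c] when all points of
    [L] have first, second, third coordinate divisible by them. *)
Lemma diagonal_image_int_vectors (R : realType) (L : set 'rV[R]_3) (a b c : R)
    (s t r : int) (Q : int -> int -> int -> Prop) :
    let P (k l m : int) := L (vec3 (k%:~R * a) (l%:~R * b) (m%:~R * c)) in
    [/\ a != 0, b != 0 & c != 0] -> [/\ s != 0, t != 0 & r != 0] ->
    (forall v, L v -> exists k l m : int,
       v = vec3 (k%:~R * a) (l%:~R * b) (m%:~R * c)) ->
    (forall k l m, P (k * s) (l * t) (m * r) <-> Q k l m) ->
    (forall k l m, P k l m -> [/\ (s %| k)%Z, (t %| l)%Z & (r %| m)%Z]) ->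
  exists2 D, diagonal_transformation D &
    lattice_image L (invmx D) = int_vectors R Q.
Proof.
move=> P [a0 b0 c0] [s0 t0 r0] LP PQ Pdiv.
pose D := diag_mx (vec3 (s%:~R * a) (t%:~R * b) (r%:~R * c)).
have Dunit : D \in unitmx.
  rewrite unitmxE det_diag unitfE; apply/prodf_neq0 => i _.
  by case: i => [[|[|[|//]]] p]; rewrite mxE /= mulf_neq0 ?intr_eq0.
exists D; first by split=> //; exact: diag_mx_is_diag.
apply/seteqP; split=> v.
  move=> [w Lw <-]; have [k [l [m ew]]] := LP _ Lw.
  have Pk : P k l m by rewrite /P -ew.
  have [/dvdzP[k' ek] /dvdzP[l' el] /dvdzP[m' em]] := Pdiv _ _ _ Pk.
  exists k', l', m'; split; last by apply/PQ; rewrite -ek -el -em.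
  by rewrite ew ek el em !intrM -!mulrA -vec3_diag mulmxK.
move=> [k [l [m [-> /PQ Pk]]]]; exists (vec3 k%:~R l%:~R m%:~R *m D).
  by rewrite vec3_diag !mulrA -!intrM.
by rewrite mulmxK.
Qed.

Theorem lemma4p3 (R : realType) (L : set 'rV[R]_3)
    (hL : is_lattice 3 L) (hpres : preserved_by L (D2_tilde R)) :
  exists D : 'M[R]_3, diagonal_transformation D /\
    [set Lambda100 R;
         Lambda111 R;
         Lambda110 R;
         lattice_oplus (Lambda11 R) (e3 R);
         lattice_oplus (lattice_scale 2 (Lambda10 R)) (e1 R + e3 R);
         lattice_oplus (lattice_scale 2 (Lambda10 R)) (e2 R + e3 R)]
      (lattice_image L (invmx D)).
Proof.
have [ex ey ez] := vec3_axis R.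
have [a [b [c [abc0 [Px Py Pz LP]]]]] := D2_tilde_lattice_half_axes hL hpres.
pose P (k l m : int) := L (vec3 (k%:~R * a) (l%:~R * b) (m%:~R * c)).
have PB k l m k' l' m' : P k l m -> P k' l' m' -> P (k - k') (l - l') (m - m').
  rewrite /P !intrB !mulrBl -vec3B.
  by case: hL => B _ ->; exact: int_spanB.
have realize s t r Q := @diagonal_image_int_vectors R L a b c s t r Q abc0.
have e13 : e1 R + e3 R = vec3 1%:~R 0%:~R 1.
  by rewrite /e1 /e3 ex ez vec3D !(addr0, add0r).
have e23 : e2 R + e3 R = vec3 0%:~R 1%:~R 1.
  by rewrite /e2 /e3 ey ez vec3D !(addr0, add0r).
rewrite e13 e23 !double_Lambda10_oplusE Lambda11_oplusE.
rewrite Lambda100E Lambda111E Lambda110E.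
case: (parity_subgroup_classification PB Px Py Pz) => [|[|[|[|[|]]]]] PE.
- have [||D diagD eD] := realize 2 2 2 (fun _ _ _ => True)
    (And3 isT isT isT) LP.
  + by move=> k l m; apply: iff_trans (PE _ _ _) _; lia.
  + by move=> k l m /PE[? []].
  by exists D; split=> //; rewrite eD; do 5 left.
- have [||D diagD eD] := realize 1 1 1
    (fun k l m => (k = l %[mod 2])%Z /\ (l = m %[mod 2])%Z)
    (And3 isT isT isT) LP.
  + by move=> k l m; rewrite !mulr1; exact: PE.
  + by move=> k l m _; rewrite !dvd1z.
  by exists D; split=> //; rewrite eD; (do 4 left); right.
- have [||D diagD eD] := realize 1 1 1
    (fun k l m => (2 %| k + l + m)%Z)
    (And3 isT isT isT) LP.
  + by move=> k l m; rewrite !mulr1; exact: PE.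
  + by move=> k l m _; rewrite !dvd1z.
  by exists D; split=> //; rewrite eD; (do 3 left); right.
- have [||D diagD eD] := realize 1 1 2 (fun k l m => (2 %| k + l)%Z)
    (And3 isT isT isT) LP.
  + by move=> k l m; apply: iff_trans (PE _ _ _) _; lia.
  + by move=> k l m /PE[_ ?].
  by exists D; split=> //; rewrite eD; (do 2 left); right.
- have [||D diagD eD] := realize 1 1 1
    (fun k l m => (k = 1 * m %[mod 2])%Z /\ (l = 0 * m %[mod 2])%Z)
    (And3 isT isT isT) LP.
  + by move=> k l m; apply: iff_trans (PE _ _ _) _; lia.
  + by move=> k l m _; rewrite !dvd1z.
  by exists D; split=> //; rewrite eD; left; right.
- have [||D diagD eD] := realize 1 1 1
    (fun k l m => (k = 0 * m %[mod 2])%Z /\ (l = 1 * m %[mod 2])%Z)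
    (And3 isT isT isT) LP.
  + by move=> k l m; apply: iff_trans (PE _ _ _) _; lia.
  + by move=> k l m _; rewrite !dvd1z.
  by exists D; split=> //; rewrite eD; right.
Qed.
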